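(* Let $\mathscr{F}(\tau)=\{A_1(\tau),A_2(\tau),\ldots,A_M(\tau)\}$ be a family of real $N\times N$ matrices depending on a real parameter $\tau$, which is quasi-controllable and continuous at $\tau=0$. Suppose that the difference equation $x(n+1)=A(n)x(n)$ is not Lyapunov absolutely stable with respect to the family $\mathscr{F}(0)$. Then, for all sufficiently small $\tau$, the equation $x(n+1)=A(n)x(n)$ is not Lyapunov absolutely stable with respect to the family $\mathscr{F}(\tau)$ and, in fact, is absolutely exponentially unstable with respect to the family $\mathscr{F}(\tau)$.
   Context: A finite family $\mathscr{F}$ of real $N\times N$ matrices is called quasi-controllable if no nonzero proper subspace of $\mathbb{R}^N$ is invariant for all matrices from $\mathscr{F}$; $\mathscr{F}(\tau)$ is quasi-controllable at $\tau=0$ if $\mathscr{F}(0)$ is quasi-controllable. $\mathscr{F}(\tau)$ is continuous at $\tau=0$ if each $A_i(\tau)$ is. Let $\|\cdot\|$ be a fixed norm on $\mathbb{R}^N$. The equation $x(n+1)=A(n)x(n)$, $n=0,1,2,\ldots$, is Lyapunov absolutely stable with respect to a family $\mathscr{F}$ if there exists $\mu<\infty$ such that for each sequence $A(n)\in\mathscr{F}$ any solution $x(n)$ of the corresponding equation satisfies $\sup_{n\ge 0}\|x(n)\|\le\mu\|x(0)\|$. The equation is absolutely exponentially unstable with degree $\lambda>1$ in (with respect to) the family $\mathscr{F}$ if for some $\kappa>0$ and for each vector $x\in\mathbb{R}^N$, $x\neq 0$, there exists a sequence $A(n)\in\mathscr{F}$ such that the solution $x(n)$ with initial condition $x(0)=x$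 satisfies $\|x(n)\|\ge\kappa\lambda^n\|x(0)\|$ for $n=0,1,2,\ldots$. It is absolutely exponentially unstable if this holds with some degree $\lambda>1$. ''For all sufficiently small $\tau$'' means for all $\tau$ with $|\tau|$ sufficiently small. *)

(* Defs.v *)
From HB Require Import structures.
From mathcomp Require Import all_boot all_order all_algebra.
From mathcomp Require Import all_classical all_reals all_analysis.

Set Implicit Arguments.
Unset Strict Implicit.
Unset Printing Implicit Defensive.

Import Order.TTheory GRing.Theory Num.Theory.
Import numFieldNormedType.Exports.

Local Open Scope classical_set_scope.
Local Open Scope ring_scope.

(* Vectors of R^N are column vectors, so that a matrix A acts by x |-> A *m x.
   MathComp's `|x| on matrices is the max-norm; since the norm is arbitrary, it
   is represented by a function satisfying the norm axioms. *)
Record is_norm (R : realType) (N : nat) (nrm : 'cV[R]_N -> R) : Prop := IsNorm {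
  is_norm_triangle : forall x y, nrm (x + y) <= nrm x + nrm y;
  is_norm_homog : forall (a : R) x, nrm (a *: x) = `|a| * nrm x;
  is_norm_eq0 : forall x, nrm x = 0 -> x = 0
}.

(* This includes families that are not finite; finiteness comes from [matrix_family]. *)
Definition quasi_controllable (R : realType) (N : nat) (F : set 'M[R]_N) : Prop :=
  forall U : {vspace 'cV[R]_N},
    (forall A, F A -> forall x, x \in U -> A *m x \in U) ->
    U = 0%VS \/ U = fullv.

Definition matrix_family (R : realType) (N M : nat) (A : 'I_M -> R -> 'M[R]_N) (tau : R) :
    set 'M[R]_N :=
  [set A i tau | i in [set: 'I_M]].

Definition solution (R : realType) (N : nat) (A : nat -> 'M[R]_N)
    (x : nat -> 'cV[R]_N) : Prop :=
  forall n, x n.+1 = A n *m x n.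

(* The supremum is taken in the extended reals: the library's real-valued [sup]
   of an unbounded set is 0. *)
Definition absolutely_stable (R : realType) (N : nat) (nrm : 'cV[R]_N -> R)
    (F : set 'M[R]_N) : Prop :=
  exists mu : R, forall A : nat -> 'M[R]_N, (forall n, F (A n)) ->
    forall x, solution A x ->
      (ereal_sup (range (fun n => (nrm (x n))%:E)) <= (mu * nrm (x 0%N))%:E)%E.

Definition absolutely_exp_unstable_deg (R : realType) (N : nat)
    (nrm : 'cV[R]_N -> R) (F : set 'M[R]_N) (lambda : R) : Prop :=
  exists2 kappa : R, 0 < kappa &
    forall x0 : 'cV[R]_N, x0 != 0 ->
      exists (A : nat -> 'M[R]_N) (x : nat -> 'cV[R]_N),
        [/\ forall n, F (A n), solution A x, x 0%N = x0 &
            forall n, kappa * lambda ^+ n * nrm (x 0%N) <= nrm (x n)].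

Definition absolutely_exp_unstable (R : realType) (N : nat)
    (nrm : 'cV[R]_N -> R) (F : set 'M[R]_N) : Prop :=
  exists2 lambda : R, 1 < lambda & absolutely_exp_unstable_deg nrm F lambda.

(* Main.v *)
Require Import Defs.
From mathcomp Require Import all_boot all_order all_algebra.
From mathcomp Require Import all_classical all_reals all_analysis.

Set Implicit Arguments.
Unset Strict Implicit.
Unset Printing Implicit Defensive.

Import Order.TTheory GRing.Theory Num.Theory.
Import numFieldNormedType.Exports.

Local Open Scope classical_set_scope.
Local Open Scope ring_scope.

(** Write a finite product of matrices of the family as a word [w] in the indices.
At tau = 0 the vectors whose orbit under all words is bounded form an invariant
subspace.  It is not the whole space: boundedness of the orbits of the basis
vectors bounds all words uniformly, which is absolute stability.  By
quasi-controllability it is therefore zero, so every [x != 0] has a word that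
multiplies its norm by more than 2 ([unbounded_orbit]).

The inequality is strict and the word is fixed, so by continuity the same word
still at least doubles all vectors near [x] for all tau near 0.  The unit sphere
is compact, hence finitely many words serve all directions: for every tau near 0
there is a bound [K] such that every nonzero vector is at least doubled by some
word of length at most [K] ([uniform_growth]).

For such a tau, start from any nonzero vector and apply doubling words one after
the other.  If [lambda ^+ K <= 2], the norm grows at least like [lambda ^+ n] at the
ends of the words; in the middle of a word it cannot be much smaller, since the
at most [K] remaining matrices could not make up for it
([exp_unstable_of_uniform_growth]).  Exponential growth excludes stability
([exp_unstable_not_stable]). *)

(** * Norms on a finite-dimensional space *)

Lemma nrm0 (R : realType) (N : nat) (nrm : 'cV[R]_N -> R) :
  is_norm nrm -> nrm 0 = 0.
Proof. by move=> nP; rewrite -(scale0r 0) (is_norm_homog nP) normr0 mul0r. Qed.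

Lemma nrmN (R : realType) (N : nat) (nrm : 'cV[R]_N -> R) (x : 'cV[R]_N) :
  is_norm nrm -> nrm (- x) = nrm x.
Proof.
by move=> nP; rewrite -scaleN1r (is_norm_homog nP) normrN1 mul1r.
Qed.

Lemma nrm_ge0 (R : realType) (N : nat) (nrm : 'cV[R]_N -> R) (x : 'cV[R]_N) :
  is_norm nrm -> 0 <= nrm x.
Proof.
move=> nP; have := is_norm_triangle nP x (- x).
by rewrite subrr nrm0 // nrmN // -mulr2n pmulrn_lge0.
Qed.

Lemma nrm_gt0 (R : realType) (N : nat) (nrm : 'cV[R]_N -> R) (x : 'cV[R]_N) :
  is_norm nrm -> x != 0 -> 0 < nrm x.
Proof.
move=> nP x0; rewrite lt_neqAle nrm_ge0 // andbT.
by apply: contra x0 => /eqP/esym/(is_norm_eq0 nP)/eqP.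
Qed.

Lemma nrm_sum (R : realType) (N : nat) (nrm : 'cV[R]_N -> R) (I : finType)
    (F : I -> 'cV[R]_N) :
  is_norm nrm -> nrm (\sum_i F i) <= \sum_i nrm (F i).
Proof.
move=> nP; elim/big_ind2: _ => [|x a y b xa yb|//]; first by rewrite nrm0.
exact: le_trans (is_norm_triangle nP _ _) (lerD xa yb).
Qed.

Lemma entry_le_mx_norm (R : realType) (m n : nat) (x : 'M[R]_(m, n)) i j :
  `|x i j| <= `|x|.
Proof.
by rewrite [leRHS]/Num.Def.normr /= mx_normrE; apply/bigmax_geP; right; exists (i, j).
Qed.

(** Bounds every linear map by its values on the standard basis; with [A = 1%:M] it
compares [nrm] with the max-norm, and with a word it turns bounds on the orbits of
the basis vectors into a bound that is uniform in the word. *)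
Lemma nrm_mulmx_le (R : realType) (N : nat) (nrm : 'cV[R]_N -> R)
    (A : 'M[R]_N) (x : 'cV[R]_N) :
  is_norm nrm ->
  nrm (A *m x) <= `|x| * \sum_j nrm (A *m delta_mx j 0).
Proof.
move=> nP.
have -> : A *m x = \sum_j x j 0 *: (A *m delta_mx j 0).
  rewrite {1}[x]matrix_sum_delta mulmx_sumr; apply: eq_bigr => j _.
  by rewrite big_ord1 scalemxAr.
apply: le_trans (nrm_sum _ nP) _; rewrite mulr_sumr; apply: ler_sum => j _.
by rewrite (is_norm_homog nP) ler_wpM2r ?nrm_ge0 // entry_le_mx_norm.
Qed.

Lemma nrm_continuous (R : realType) (N : nat) (nrm : 'cV[R]_N -> R) :
  is_norm nrm -> continuous nrm.
Proof.
move=> nP x.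
pose c := \sum_j nrm (delta_mx j 0) + 1.
have c_gt0 : 0 < c by rewrite ltr_wpDl // sumr_ge0 // => j _; apply: nrm_ge0.
have nrm_le y : nrm y <= c * `|y|.
  rewrite -[y in nrm y]mul1mx; apply: le_trans (nrm_mulmx_le _ _ nP) _.
  under eq_bigr do rewrite mul1mx.
  by rewrite mulrC ler_wpM2r // lerDl.
have nrm_lip y z : nrm y - nrm z <= nrm (y - z).
  by rewrite lerBlDr -{1}[y](subrK z); apply: is_norm_triangle.
apply/(@cvgrPdist_le _ _ _ _ (nbhs_filter x)) => e e0.
apply/nbhs_ballP; exists (c^-1 * e) => [|y]; first by rewrite /= mulr_gt0 ?invr_gt0.
rewrite -ball_normE /= => /ltW; rewrite ler_pdivlMl // => xy.
apply: le_trans xy; apply: le_trans (nrm_le _).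
by rewrite ler_norml nrm_lip andbT lerNl opprB -(nrmN (x - y) nP) opprB nrm_lip.
Qed.

(** Transposition is an isometry, so Heine-Borel for row vectors carries over. *)
Lemma mx_sphere_compact (R : realType) (N : nat) :
  compact [set x : 'cV[R]_N | `|x| = 1].
Proof.
have trE m n (y : 'M[R]_(m, n)) : `|y^T| = `|y|.
  suff trle p q (z : 'M[R]_(p, q)) : `|z^T| <= `|z|.
    by apply/eqP; rewrite eq_le trle -{1}[y]trmxK trle.
  rewrite [leLHS]/Num.Def.normr /= mx_normrE; apply: bigmax_le => // -[i j] _ /=.
  by rewrite mxE entry_le_mx_norm.
have tr_cont : continuous (@trmx R 1 N).
  move=> y; apply/(@cvgrPdist_le _ _ _ _ (nbhs_filter y)) => e e0.
  apply/nbhs_ballP; exists e => //= z.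
  by rewrite -ball_normE /= -linearB trE => /ltW.
have -> : [set x : 'cV[R]_N | `|x| = 1] =
    @trmx R 1 N @` [set y : 'rV[R]_N | `|y| = 1].
  apply/seteqP; split => [x /= x1|_ [y y1 <-]] /=; last by rewrite trE.
  by exists x^T; rewrite ?trmxK //= trE.
apply: continuous_compact; first exact: continuous_subspaceT.
apply: bounded_closed_compact.
  exists 1; split; first exact: num_real.
  by move=> M M1 y /= ->; apply: ltW.
rewrite [X in closed X](_ : _ = Num.norm @^-1` [set 1]) //.
by apply: preimage_closed => [y _|]; [exact: norm_continuous|exact: closed_eq].
Qed.

(** The other half of the equivalence of norms: [nrm] is continuous and positive on
the compact max-norm sphere, so it has a positive minimum there. *)
Lemma mx_norm_le_nrm (R : realType) (N : nat) (nrm : 'cV[R]_N -> R) :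
  is_norm nrm -> exists2 c : R, 0 < c & forall x, `|x| <= c * nrm x.
Proof.
move=> nP.
have [[x0 x0S]|S0] := pselect ([set x : 'cV[R]_N | `|x| = 1] !=set0); last first.
  (* an empty sphere means N = 0, and every vector is 0 *)
  exists 1 => // x; rewrite mul1r.
  have [->|x0] := eqVneq x 0; first by rewrite normr0 nrm_ge0.
  case: S0; exists (`|x|^-1 *: x).
  by rewrite /= normrZ normfV normr_id mulVf // normr_eq0.
have [] := @compact_EVT_min _ R nrm [set x : 'cV[R]_N | `|x| = 1].
- by exists x0.
- exact: mx_sphere_compact.
- exact/continuous_subspaceT/nrm_continuous.
move=> c; rewrite inE /= => c1 cmin.
have c0 : c != 0 by rewrite -normr_eq0 c1 oner_eq0.
exists (nrm c)^-1; first by rewrite invr_gt0 nrm_gt0.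
move=> x; have [->|x0'] := eqVneq x 0; first by rewrite normr0 nrm0 // mulr0.
rewrite mulrC ler_pdivlMr ?nrm_gt0 // mulrC -ler_pdivlMr ?normr_gt0 //.
have := cmin (`|x|^-1 *: x); rewrite (is_norm_homog nP) normfV normr_id mulrC.
apply; rewrite inE /= normrZ normfV normr_id mulVf // normr_eq0 //.
Qed.

(** * Words, and unbounded orbits at tau = 0 *)

(** The word is read from left to right in time, so the matrix of its first letter is
the rightmost factor: peeling off the first letter is one step of the equation. *)
Definition word_mx (R : realType) (N : nat) (I : Type) (B : I -> 'M[R]_N)
    (w : seq I) : 'M[R]_N :=
  foldr (fun i P => P *m B i) 1%:M w.

Lemma word_mx_rcons (R : realType) (N : nat) (I : Type) (B : I -> 'M[R]_N)
    (w : seq I) (i : I) :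
  word_mx B (rcons w i) = B i *m word_mx B w.
Proof.
elim: w => [|j w IHw] /=; first by rewrite mul1mx mulmx1.
by rewrite IHw mulmxA.
Qed.

Lemma solution_word_mx (R : realType) (N : nat) (I : Type) (B : I -> 'M[R]_N)
    (i : nat -> I) (x : nat -> 'cV[R]_N) (n : nat) :
  solution (B \o i) x -> x n = word_mx B (mkseq i n) *m x 0%N.
Proof.
move=> xP; elim: n => [|n IHn]; first by rewrite mul1mx.
by rewrite mkseqS word_mx_rcons -mulmxA -IHn xP.
Qed.

(** Subspaces are detachable objects rather than predicates; in finite dimension a
subspace of maximal dimension inside a linearly closed predicate exhausts it. *)
Lemma vspace_of_linear_closed (K : fieldType) (V : vectType K) (P : V -> Prop) :
  P 0 -> (forall (a : K) u v, P u -> P v -> P (a *: u + v)) ->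
  exists U : {vspace V}, forall x, x \in U <-> P x.
Proof.
move=> P0 Plin.
pose S (U : {vspace V}) := forall x, x \in U -> P x.
have exd : exists d, `[<exists2 U, S U & \dim U = d>].
  exists 0%N; apply/asboolP; exists 0%VS; last by rewrite dimv0.
  by move=> x; rewrite memv0 => /eqP->.
have dub d : `[<exists2 U, S U & \dim U = d>] -> (d <= \dim {:V})%N.
  by move=> /asboolP[U _ <-]; rewrite dimvS ?subvf.
case: (ex_maxnP exd dub) => d /asboolP[U SU dimU] dmax.
exists U => x; split=> [|Px]; first exact: SU.
have SUx : S (<[x]> + U)%VS.
  by move=> _ /memv_addP[_ /vlineP[a ->] [v vU ->]]; apply/Plin/SU.
have /eqP-> : U == (<[x]> + U)%VS.
  by rewrite eqEdim addvSr dimU dmax //; apply/asboolP; exists (<[x]> + U)%VS.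
by rewrite memvE addvSl.
Qed.

Lemma absolutely_stable_of_bounded_orbits (R : realType) (N M : nat)
    (nrm : 'cV[R]_N -> R) (B : 'I_M -> 'M[R]_N) :
  is_norm nrm ->
  (forall x, exists b, forall w, nrm (word_mx B w *m x) <= b) ->
  absolutely_stable nrm [set B i | i in [set: 'I_M]].
Proof.
move=> nP bounded.
have /choice[b bP] j := bounded (delta_mx j 0).
have [c c_gt0 cP] := mx_norm_le_nrm nP.
exists (c * \sum_j b j) => A AB x xP.
have /choice[i iP] n : exists i, B i = A n by have [i _ <-] := AB n; exists i.
have {}iP : B \o i = A by apply/funext => n; apply: iP.
apply: ge_ereal_sup => _ [n _ <-]; rewrite lee_fin.
rewrite -iP in xP; rewrite (solution_word_mx n xP).
apply: le_trans (nrm_mulmx_le _ _ nP) _; rewrite mulrAC.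
apply: ler_pM => //; first by apply: sumr_ge0 => j _; apply: nrm_ge0.
exact: ler_sum.
Qed.

(** The vectors with bounded orbit form an invariant subspace; instability keeps it
from being everything, so by quasi-controllability it is zero. *)
Lemma unbounded_orbit (R : realType) (N M : nat)
    (nrm : 'cV[R]_N -> R) (B : 'I_M -> 'M[R]_N) (x : 'cV[R]_N) (b : R) :
  is_norm nrm ->
  quasi_controllable [set B i | i in [set: 'I_M]] ->
  ~ absolutely_stable nrm [set B i | i in [set: 'I_M]] ->
  x != 0 -> exists w, b < nrm (word_mx B w *m x).
Proof.
move=> nP qc unst x0; apply: contrapT => nb; apply: unst.
apply: absolutely_stable_of_bounded_orbits => //.
pose P y := exists b, forall w, nrm (word_mx B w *m y) <= b.
have [U UP] : exists U : {vspace 'cV[R]_N}, forall y, y \in U <-> P y.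
  apply: vspace_of_linear_closed => [|a u v [bu buP] [bv bvP]].
    by exists 0 => w; rewrite mulmx0 nrm0.
  exists (`|a| * bu + bv) => w; rewrite mulmxDr -scalemxAr.
  apply: le_trans (is_norm_triangle nP _ _) _; rewrite (is_norm_homog nP).
  by rewrite lerD ?ler_wpM2l.
have xU : x \in U.
  apply/UP; exists b => w; rewrite leNgt; apply/negP => bw.
  by apply: nb; exists w.
have [A [i _ <-] y /UP[c cP]||] := qc U.
- by apply/UP; exists c => w; rewrite mulmxA; apply: (cP (i :: w)).
- by move=> U0; move: xU; rewrite U0 memv0 (negPf x0).
- by move=> UT y; apply/UP; rewrite UT memvf.
Qed.

(** * Uniform growth for small tau *)

Lemma cvg_mulmx (R : realType) (m n p : nat) (T : Type) (F : set_system T)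
    (f : T -> 'M[R]_(m, n)) (g : T -> 'M[R]_(n, p))
    (a : 'M[R]_(m, n)) (b : 'M[R]_(n, p)) :
  Filter F -> f @ F --> a -> g @ F --> b -> (fun t => f t *m g t) @ F --> a *m b.
Proof.
move=> FF fa gb.
have ent i j : (fun t => (f t *m g t) i j) @ F --> (a *m b) i j.
  rewrite mxE.
  have -> : (fun t => (f t *m g t) i j) = (fun t => \sum_k f t i k * g t k j).
    by apply/funext => t; rewrite mxE.
  apply: cvg_big => [|k _]; first exact: add_continuous.
  apply: cvgM.
    exact: (cvg_comp _ _ fa (@coord_continuous _ _ _ i k a)).
  exact: (cvg_comp _ _ gb (@coord_continuous _ _ _ k j b)).
move=> S [P Pab PS]; rewrite nbhs_filterE.
apply: (@filterS _ F _ (fun t => forall i j, P i j ((f t *m g t) i j))).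
  by move=> t Pt; apply: PS.
apply: filter_forall => i; apply: filter_forall => j.
exact: (ent i j _ (Pab i j)).
Qed.

Lemma cvg_word_mx (R : realType) (N : nat) (I : Type) (T : Type)
    (F : set_system T) (f : T -> I -> 'M[R]_N) (B : I -> 'M[R]_N) (w : seq I) :
  Filter F -> (forall i, (f ^~ i) @ F --> B i) ->
  (fun t => word_mx (f t) w) @ F --> word_mx B w.
Proof.
move=> FF fB; elim: w => [|i w IHw] /=; first exact: cvg_cst.
exact: cvg_mulmx.
Qed.

(** A strictly growing word for [x] at tau = 0 keeps growing near [(x, 0)], and
compactness of the sphere leaves only finitely many words to use. *)
Lemma uniform_growth (R : realType) (N M : nat) (nrm : 'cV[R]_N -> R)
    (A : 'I_M -> R -> 'M[R]_N) (q : R) :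
  is_norm nrm ->
  (forall i : 'I_M, {for 0, continuous (A i)}) ->
  (forall x, x != 0 -> exists w, q * nrm x < nrm (word_mx (A ^~ 0) w *m x)) ->
  \forall tau \near (0 : R), exists K : nat, forall x, x != 0 ->
    exists2 w, (size w <= K)%N & q * nrm x <= nrm (word_mx (A ^~ tau) w *m x).
Proof.
move=> nP Acont grow.
(* The length bound is made a second parameter tending to infinity: then the
   near-covering form of compactness yields at once a neighbourhood of 0 and a
   length that suit the whole sphere. *)
pose P (tK : R * nat) (x : 'cV[R]_N) := exists2 w, (size w <= tK.2)%N &
  q * nrm x <= nrm (word_mx (A ^~ tK.1) w *m x).
have cover : \forall tK \near filter_prod (nbhs (0 : R)) \oo,
    [set x : 'cV[R]_N | `|x| = 1] `<=` P tK.
  have /compact_near_coveringP := @mx_sphere_compact R N; apply => x /= x1.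
  have x0 : x != 0 by rewrite -normr_eq0 x1 oner_eq0.
  have [w wP] := grow x x0.
  pose G := filter_prod (nbhs x) (filter_prod (nbhs (0 : R)) \oo).
  have cvg_x : (fun z : 'cV[R]_N * (R * nat) => z.1) @ G --> x by exact: cvg_fst.
  have cvg_tau : (fun z : 'cV[R]_N * (R * nat) => z.2.1) @ G --> (0 : R).
    exact: (cvg_comp _ _ cvg_snd cvg_fst).
  have cvg_K : (fun z : 'cV[R]_N * (R * nat) => z.2.2) @ G --> \oo.
    exact: (cvg_comp _ _ cvg_snd cvg_snd).
  have cvg_w : (fun z : 'cV[R]_N * (R * nat) =>
      nrm (word_mx (A ^~ z.2.1) w *m z.1) - q * nrm z.1) @ G -->
      nrm (word_mx (A ^~ 0) w *m x) - q * nrm x.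
    apply: cvgB.
      apply: continuous_cvg; first exact: nrm_continuous.
      apply: cvg_mulmx => //; apply: cvg_word_mx => i.
      exact: (cvg_comp _ _ cvg_tau (Acont i)).
    apply: cvgM; first exact: cvg_cst.
    by apply: continuous_cvg => //; exact: nrm_continuous.
  have gt0 : 0 < nrm (word_mx (A ^~ 0) w *m x) - q * nrm x by rewrite subr_gt0.
  have FG : Filter G by exact: filter_prod_filter.
  have Gpos := @cvgr_gt _ _ G FG _ _ cvg_w _ gt0.
  have GK := cvg_K _ (nbhs_infty_ge (size w)).
  have GP : G (fun z => P z.2 z.1).
    apply: (@filterS2 _ G _ _ _ _ _ Gpos GK) => z /= zpos zK; exists w => //.
    by rewrite -subr_ge0 ltW.
  exact: GP.
case: cover => -[U V] [/= U0 [k _ kV]] UVP.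
apply: filterS U0 => tau Utau; exists k => x x0.
have [] := UVP (tau, k) _ (`|x|^-1 *: x).
- by split => //; apply: kV => /=.
- by rewrite /= normrZ normfV normr_id mulVf // normr_eq0.
move=> w wk; rewrite -scalemxAr !(is_norm_homog nP) mulrCA.
rewrite ler_pM2l ?normr_gt0 ?invr_eq0 ?normr_eq0 //.
by exists w.
Qed.

(** * From uniform growth to exponential instability *)

Lemma operator_bound (R : realType) (N : nat) (I : finType)
    (nrm : 'cV[R]_N -> R) (B : I -> 'M[R]_N) :
  is_norm nrm ->
  exists2 C : R, 1 <= C & forall i x, nrm (B i *m x) <= C * nrm x.
Proof.
move=> nP; have [c c_gt0 cP] := mx_norm_le_nrm nP.
pose b i := c * \sum_j nrm (B i *m delta_mx j 0).
have b_ge0 i : 0 <= b i.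
  by rewrite mulr_ge0 ?(ltW c_gt0) ?sumr_ge0 // => j _; apply: nrm_ge0.
exists (1 + \sum_i b i) => [|i x]; first by rewrite lerDl sumr_ge0.
apply: le_trans (nrm_mulmx_le _ _ nP) _.
apply: (@le_trans _ _ (b i * nrm x)).
  by rewrite /b mulrAC ler_wpM2r // sumr_ge0 // => j _; apply: nrm_ge0.
rewrite ler_wpM2r ?nrm_ge0 // (bigD1 i) //= addrCA lerDl.
by rewrite addr_ge0 // sumr_ge0.
Qed.

Lemma word_mx_bound (R : realType) (N : nat) (I : Type)
    (nrm : 'cV[R]_N -> R) (B : I -> 'M[R]_N) (C : R) (w : seq I) x :
  0 <= C -> (forall i x, nrm (B i *m x) <= C * nrm x) ->
  nrm (word_mx B w *m x) <= C ^+ size w * nrm x.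
Proof.
move=> C0 CP; elim: w x => [|i w IHw] x /=; first by rewrite mul1mx mul1r.
rewrite -mulmxA exprSr -mulrA; apply: le_trans (IHw _) _.
by rewrite ler_wpM2l ?exprn_ge0.
Qed.

Lemma exists_root_gt1 (R : realType) (K : nat) :
  exists2 lambda : R, 1 < lambda & lambda ^+ K <= 2.
Proof.
case: K => [|K]; first by exists 2; rewrite ?expr0 ?ltr1n ?ler1n.
exists (2 `^ K.+1%:R^-1).
  have V0 : 0 < K.+1%:R^-1 :> R by rewrite invr_gt0 ltr0Sn.
  have := @gt0_ltr_powR R _ V0 1 2; rewrite powR1; apply.
  - by rewrite nnegrE.
  - by rewrite nnegrE.
  - by rewrite ltr1n.
by rewrite -powR_mulrn ?powR_ge0 // -powRrM mulVf ?pnatr_eq0 // powRr1.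
Qed.

(** Concatenates growing words.  The potential that never falls behind [lam ^+ n] is
not the norm of the current state but the norm that the state will reach at the end
of the current word, compared with the time at which it will reach it. *)
Lemma exp_unstable_of_uniform_growth (R : realType) (N M : nat)
    (nrm : 'cV[R]_N -> R) (B : 'I_M -> 'M[R]_N) (K : nat) :
  is_norm nrm ->
  (forall x, x != 0 -> exists2 w, (size w <= K)%N &
    2 * nrm x <= nrm (word_mx B w *m x)) ->
  absolutely_exp_unstable nrm [set B i | i in [set: 'I_M]].
Proof.
move=> nP grow.
have [C C1 CP] := operator_bound B nP.
have C0 : 0 < C := lt_le_trans ltr01 C1.
have [lam lam1 lamK] := @exists_root_gt1 R K.
have lam0 : 0 < lam := lt_trans ltr01 lam1.
have {}grow x : exists w, x != 0 ->
    (size w <= K)%N /\ 2 * nrm x <= nrm (word_mx B w *m x).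
  have [->|x0] := eqVneq x 0; first by exists [::].
  by have [w] := grow x x0; exists w.
have {grow} /choice[W WP] := grow.
have Wn0 x : x != 0 -> W x != [::].
  move=> x0; apply/eqP => W0; have [_] := WP x x0.
  rewrite W0 mul1mx -subr_ge0 mulr2n mulrDl mul1r opprD addrA subrr add0r.
  by rewrite oppr_ge0 leNgt nrm_gt0.
exists lam => //; exists (C ^- K); first by rewrite invr_gt0 exprn_gt0.
move=> x0 x0n0.
have i0 : 'I_M by case: (W x0) (Wn0 x0 x0n0).
(* A state is the current vector with the rest of the current word; the rest is
   renewed as soon as it becomes empty, so there is always a next letter. *)
pose step (s : 'cV[R]_N * seq 'I_M) :=
  let x := B (head i0 s.2) *m s.1 in
  (x, if behead s.2 is [::] then W x else behead s.2).
pose st n := iter n step (x0, W x0).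
(* renewing the word preserves the invariant [inv] below *)
have fresh n x : lam ^+ n * nrm x0 <= nrm x ->
    [/\ W x != [::], (size (W x) <= K)%N &
        lam ^+ (n + size (W x)) * nrm x0 <= nrm (word_mx B (W x) *m x)].
  move=> nx; have xn0 : x != 0.
    apply: contraTneq nx => ->; rewrite nrm0 // -ltNge.
    by rewrite mulr_gt0 ?exprn_gt0 ?nrm_gt0.
  have [WK W2] := WP x xn0; split=> //; first exact: Wn0.
  apply: le_trans W2; rewrite exprD mulrAC mulrC ler_pM ?nrm_ge0 //.
  - by rewrite exprn_ge0 ?ltW.
  - by rewrite mulr_ge0 ?exprn_ge0 ?nrm_ge0 ?ltW.
  - by apply: le_trans lamK; rewrite ler_weXn2l // ltW.
have inv n : [/\ (st n).2 != [::], (size (st n).2 <= K)%N &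
    lam ^+ (n + size (st n).2) * nrm x0 <=
      nrm (word_mx B (st n).2 *m (st n).1)].
  elim: n => [|n]; first by apply: fresh; rewrite mul1r.
  rewrite /st iterS -/(st n) /step; case: (st n) => x [|i [|j w]] /= [] // _ wK.
    by rewrite mul1mx addn1; apply: fresh.
  rewrite -mulmxA addSnnS => IH; split=> //; exact: ltnW.
exists (fun n => B (head i0 (st n).2)), (fun n => (st n).1); split.
- by move=> n; exists (head i0 (st n).2).
- by [].
- by [].
move=> n /=; have [_ wK wP] := inv n.
(* at most K letters remain, and each multiplies the norm by at most C *)
rewrite -mulrA ler_pdivrMl ?exprn_gt0 //.
apply: (@le_trans _ _ (lam ^+ (n + size (st n).2) * nrm x0)).
  by rewrite ler_wpM2r ?nrm_ge0 // ler_weXn2l ?leq_addr // ltW.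
apply: le_trans wP _; apply: le_trans (word_mx_bound _ _ (ltW C0) CP) _.
by rewrite ler_wpM2r ?nrm_ge0 // ler_weXn2l.
Qed.

Lemma exp_unstable_not_stable (R : realType) (N : nat)
    (nrm : 'cV[R]_N -> R) (F : set 'M[R]_N) (x0 : 'cV[R]_N) :
  is_norm nrm -> x0 != 0 -> absolutely_exp_unstable nrm F ->
  ~ absolutely_stable nrm F.
Proof.
move=> nP x0n0 [lam lam1 [k k0 /(_ x0 x0n0)[A [x [AF xP xx0 xge]]]]] [mu muP].
have nx0 : 0 < nrm x0 by apply: nrm_gt0.
have bnd n : lam ^+ n <= mu / k.
  rewrite ler_pdivlMr // mulrC -(ler_pM2r nx0) -xx0.
  apply: le_trans (xge n) _; rewrite -lee_fin; apply: le_trans (muP A AF x xP).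
  by apply: ereal_sup_ubound; exists n.
have [n] : exists n, mu / k < lam ^+ n.
  have c_gt0 : 0 < `|mu / k| + 1 by rewrite ltr_wpDl.
  have lamV : `|lam^-1| < 1.
    by rewrite ger0_norm ?invr_ge0 ?invf_lt1 ?ltW // (lt_trans ltr01).
  have /= cvg0 := cvg_geometric 1 lamV.
  have : \forall n \near \oo, 1 * lam^-1 ^+ n < (`|mu / k| + 1)^-1.
    by apply: (cvgr_lt _ cvg0); rewrite invr_gt0.
  case/filter_ex => n; rewrite mul1r exprVn ltf_pV2 ?posrE ?exprn_gt0 //.
    by move=> ltn; exists n; apply: le_lt_trans ltn; rewrite ler_wpDr ?ler_norm.
  exact: lt_trans lam1.
by rewrite ltNge bnd.
Qed.

Theorem theorem3p1 (R : realType) (N M : nat) (nrm : 'cV[R]_N -> R)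
    (A : 'I_M -> R -> 'M[R]_N) (nrm_norm : is_norm nrm)
    (A_qc : quasi_controllable (matrix_family A 0))
    (A_cont : forall i : 'I_M, {for 0, continuous (A i)})
    (A_unstable : ~ absolutely_stable nrm (matrix_family A 0)) :
  \forall tau \near (0 : R),
    ~ absolutely_stable nrm (matrix_family A tau) /\
    absolutely_exp_unstable nrm (matrix_family A tau).
Proof.
(* in dimension 0 every equation is stable *)
have [x0 x0n0] : exists x : 'cV[R]_N, x != 0.
  apply: contrapT => nx; apply: A_unstable; exists 0 => B _ x _.
  apply: ge_ereal_sup => _ [n _ <-]; rewrite mul0r lee_fin.
  have -> : x n = 0 by apply/eqP/negPn/negP => xn0; apply: nx; exists (x n).
  by rewrite nrm0.
have grow x : x != 0 ->
    exists w, 2 * nrm x < nrm (word_mx (A ^~ 0) w *m x).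
  exact: (@unbounded_orbit _ _ _ _ (A ^~ 0)).
apply: filterS (uniform_growth nrm_norm A_cont grow) => tau [K KP].
have unst : absolutely_exp_unstable nrm (matrix_family A tau).
  exact: (@exp_unstable_of_uniform_growth _ _ _ _ (A ^~ tau) K).
by split=> [|//]; exact: exp_unstable_not_stable nrm_norm x0n0 unst.
Qed.
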